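(* For all integers $m \geq 1$, $k \geq 1$, and $n$ with $\max(2, k - m + 2) \leq n \leq k$, \[|\mathrm{ParseWords}(\mathrm{LeftTurnTree}(m, n), \mathrm{RightTurnTree}(k, m + n - k))| = 1.\]
   Context: A binary tree is a rooted ordered tree in which each vertex has either $0$ or $2$ children; its leaves are ordered left to right. Let $G$ be the context-free grammar with start symbols $0,1,2$ and rules $0\to 12$, $0\to 21$, $1\to 02$, $1\to 20$, $2\to 01$, $2\to 10$. An $n$-leaf binary tree $T$ parses a word $w$ of length $n$ on $\{0,1,2\}$ if there is a labeling of the vertices of $T$ by $0,1,2$ such that the leaves, from left to right, are labeled with the letters of $w$, and at every internal vertex the label of the vertex together with the labels of its left and right children form a rule of $G$ (i.e. the three labels are pairwise distinct). If $T$ parses $w$, it also parses every word obtained from $w$ by permuting the alphabet $\{0,1,2\}$. For binary trees $T_1,T_2$ with the same number of leaves, $\mathrm{ParseWords}(T_1,T_2)$ denotes the set of equivalence classes (under permutations of the alphabet $\{0,1,2\}$) of words parsed by both $T_1$ and $T_2$. The level of a vertex is its distance from the root. A path tree is a binary tree with at most two vertices on each level. For $N\ge 2$, $N$-leaf path trees correspond bijectively to words $x_1\cdots x_{N-2}$ on $\{l,r\}$: $x_j=l$ (resp. $x_j=r$) means that, of the two vertices on level $j$, the left (resp. right) one has children. $\mathrm{LeftTurnTree}(p,q)$ is the $(p+q)$-leaf path tree corresponding to $l^p r^{q-2}$, and $\mathrm{RightTurnTree}(p,q)$ is the $(p+q)$-leaf path tree corresponding to $r^p l^{q-2}$. *)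

(* Defs.v *)
From mathcomp Require Import all_boot all_fingroup.

Set Implicit Arguments.
Unset Strict Implicit.
Unset Printing Implicit Defensive.

Inductive btree : Type :=
| Leaf
| Node of btree & btree.

Fixpoint nleaves (T : btree) : nat :=
  if T is Node L R then nleaves L + nleaves R else 1.

(* The labelings by 0, 1, 2 of all vertices of T: one letter per vertex. *)
Fixpoint labeling (T : btree) : finType :=
  match T with
  | Leaf => 'I_3 : finType
  | Node L R => ('I_3 * (labeling L * labeling R))%type : finType
  end.

Definition root_label (T : btree) : labeling T -> 'I_3 :=
  match T return labeling T -> 'I_3 with
  | Leaf => fun a => a
  | Node L R => fun f => f.1
  end.

Fixpoint leaf_word (T : btree) : labeling T -> seq 'I_3 :=
  match T return labeling T -> seq 'I_3 with
  | Leaf => fun a => [:: a]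
  | Node L R => fun f => leaf_word f.2.1 ++ leaf_word f.2.2
  end.

(* The rules 0 -> 12 | 21, 1 -> 02 | 20, 2 -> 01 | 10: a -> bc is a rule
   exactly when a, b, c are pairwise distinct. *)
Definition rule (a b c : 'I_3) : bool := uniq [:: a; b; c].

Fixpoint derivation (T : btree) : labeling T -> bool :=
  match T return labeling T -> bool with
  | Leaf => fun=> true
  | Node L R => fun f =>
      [&& rule f.1 (root_label f.2.1) (root_label f.2.2),
          derivation f.2.1 & derivation f.2.2]
  end.

(* The root label is unconstrained because 0, 1 and 2 are all start symbols. *)
Definition parses (T : btree) (w : seq 'I_3) : bool :=
  [exists f : labeling T, derivation f && (leaf_word f == w)].

Definition word_class (n : nat) (w : n.-tuple 'I_3) : {set n.-tuple 'I_3} :=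
  [set map_tuple s w | s : 'S_3].

(* Meant for nleaves T1 = nleaves T2; a tree only parses words of length its
   number of leaves. *)
Definition ParseWords (T1 T2 : btree) : {set {set (nleaves T1).-tuple 'I_3}} :=
  [set word_class w | w : (nleaves T1).-tuple 'I_3 & parses T1 w && parses T2 w].

Inductive turn : Type := TurnL | TurnR.

(* The path tree of x_1 ... x_(N-2): level 1 always has two vertices, and x_j
   tells which of the two vertices on level j has children; the empty word is
   the 2-leaf tree. *)
Fixpoint path_tree (x : seq turn) : btree :=
  match x with
  | [::] => Node Leaf Leaf
  | TurnL :: x' => Node (path_tree x') Leaf
  | TurnR :: x' => Node Leaf (path_tree x')
  end.

(* Both trees have p + q leaves when q >= 2; q - 2 is truncated otherwise. *)
Definition LeftTurnTree (p q : nat) : btree :=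
  path_tree (nseq p TurnL ++ nseq (q - 2) TurnR).

Definition RightTurnTree (p q : nat) : btree :=
  path_tree (nseq p TurnR ++ nseq (q - 2) TurnL).

(* Main.v *)
(* Identify the letters 0, 1, 2 with the nonzero vectors of F_2^2, so that
   a -> bc is a rule exactly when a = b + c. The label of a vertex is then the
   sum of the leaves below it, and a tree parses w exactly when all these sums
   are nonzero. In terms of the partial sums S_0, ..., S_N of w, with N = m + n,
   the left turn tree demands that S_0, ..., S_(n-1) avoid S_n and that
   S_n, ..., S_N avoid 0; the right turn tree demands that S_(k+1), ..., S_N
   avoid S_k and that S_0, ..., S_k avoid S_N. As n <= k, each of the blocks
   [0, n-1], [n, k], [k+1, N] avoids two of the four vectors, and since
   consecutive partial sums differ, S alternates between the other two. So S is
   determined by the distinct nonzero vectors S_n and S_N, which a permutation of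
   the letters can bring to any given position. *)
Require Import Defs.
From mathcomp Require Import all_boot all_fingroup.
From mathcomp Require Import ssralg zify.

Set Implicit Arguments.
Unset Strict Implicit.
Unset Printing Implicit Defensive.

Import GRing.Theory.
Local Open Scope ring_scope.

(** * Letters as nonzero vectors of F_2^2, and partial sums of words *)

Notation F22 := (bool * bool)%type.

Definition vec (a : 'I_3) : F22 := (val a != 0, val a != 1)%N.

(** Inverts [vec] on nonzero vectors only; the value at the zero vector is a junk default. *)
Definition letter (v : F22) : 'I_3 :=
  if v.1 then (if v.2 then inord 2 else inord 1) else inord 0.

Lemma vec_neq0 a : vec a != 0.
Proof. by case: a => [[|[|[|]]]]. Qed.

Lemma letterK v : v != 0 -> vec (letter v) = v.
Proof. by case: v => [[] []] // _; rewrite /vec /letter /= inordK. Qed.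

Lemma vec_inj : injective vec.
Proof.
by case=> [[|[|[|i]]] hi] [[|[|[|j]]] hj] //= _; apply: val_inj.
Qed.

Lemma ruleE a b c : rule a b c = (vec a == vec b + vec c).
Proof. by case: a b c => [[|[|[|?]]] ?] [[|[|[|?]]] ?] [[|[|[|?]]] ?]. Qed.

Definition wsum (w : seq 'I_3) : F22 := \sum_(a <- w) vec a.

Lemma wsum_cat u v : wsum (u ++ v) = wsum u + wsum v.
Proof. exact: big_cat. Qed.

Lemma wsum_rev w : wsum (rev w) = wsum w.
Proof. by apply: perm_big; rewrite perm_rev. Qed.

Definition psum (w : seq 'I_3) (i : nat) : F22 := wsum (take i w).

Lemma psum0 w : psum w 0 = 0.
Proof. by rewrite /psum take0 /wsum big_nil. Qed.

Lemma psumS w i : (i < size w)%N ->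
  psum w i.+1 = psum w i + vec (nth ord0 w i).
Proof.
by move=> hi; rewrite /psum (take_nth ord0 hi) -cats1 wsum_cat /wsum big_seq1.
Qed.

Lemma wsum_drop w i : wsum (drop i w) = wsum w - psum w i.
Proof.
by rewrite -{2}(cat_take_drop i w) wsum_cat /psum addrC addrA addNr add0r.
Qed.

Lemma psum_rev w i : (i <= size w)%N ->
  psum (rev w) i = psum w (size w) - psum w (size w - i).
Proof.
move=> hi; rewrite /psum take_rev wsum_rev take_size; exact: wsum_drop.
Qed.

(** * Parsing as nonvanishing of subtree sums *)

Lemma derivation_sum T (f : labeling T) :
  derivation f -> wsum (leaf_word f) = vec (root_label f).
Proof.
elim: T f => [a _|L IHL R IHR [a [f g]]] /=; first by rewrite /wsum big_seq1.
by case/and3P; rewrite ruleE => /eqP-> /IHL <- /IHR <-; rewrite wsum_cat.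
Qed.

Lemma parses_sum_neq0 T w : parses T w -> wsum w != 0.
Proof.
by case/existsP=> f /andP[/derivation_sum df /eqP<-]; rewrite df vec_neq0.
Qed.

Lemma parses_leaf w : parses Leaf w = (size w == 1)%N.
Proof.
apply/existsP/eqP=> [[a /andP[_ /eqP<-]] //|].
by case: w => [|a []] // _; exists a => /=.
Qed.

(** The root label can only be the sum of the two child labels, and this sum is the vector of a
    letter exactly when it is nonzero. *)
Lemma parses_nodeP L R w :
  reflect (exists u v, [/\ w = u ++ v, parses L u, parses R v & wsum w != 0])
          (parses (Node L R) w).
Proof.
apply: (iffP idP) => [pw|[u [v [-> /existsP[f]]]]].
  case/existsP: (pw) => -[a [f g]] /= /andP[/and3P[_ df dg] /eqP ew].
  exists (leaf_word f), (leaf_word g); split=> //.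
  - by apply/existsP; exists f; rewrite df eqxx.
  - by apply/existsP; exists g; rewrite dg eqxx.
  exact: parses_sum_neq0 pw.
case/andP=> df /eqP <- /existsP[g /andP[dg /eqP <-]] nz.
apply/existsP; exists (letter (wsum (leaf_word f ++ leaf_word g)), (f, g)) => /=.
rewrite eqxx ruleE df dg !andbT letterK //.
by rewrite wsum_cat !derivation_sum.
Qed.

Lemma parses_size T w : parses T w -> size w = nleaves T.
Proof.
elim: T w => [w|L IHL R IHR w]; first by rewrite parses_leaf => /eqP.
by case/parses_nodeP=> u [v [-> /IHL hu /IHR hv _]]; rewrite size_cat hu hv.
Qed.

(** * Left-right symmetry *)

Fixpoint mirror (T : btree) : btree :=
  if T is Node L R then Node (mirror R) (mirror L) else Leaf.

Lemma mirrorK : involutive mirror.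
Proof. by elim=> //= L -> R ->. Qed.

Lemma parses_mirror T w : parses (mirror T) (rev w) = parses T w.
Proof.
(* One implication suffices, since [mirror] and [rev] are involutions. *)
suff H T' w' : parses T' w' -> parses (mirror T') (rev w').
  by apply/idP/idP=> /H //; rewrite mirrorK revK.
elim: T' w' => [w'|L IHL R IHR w']; first by rewrite !parses_leaf size_rev.
case/parses_nodeP=> u [v [-> pu pv nz]]; apply/parses_nodeP.
exists (rev v), (rev u); rewrite wsum_rev; split=> //; first exact: rev_cat.
- exact: IHR.
- exact: IHL.
Qed.

Definition flip (t : turn) : turn := if t is TurnL then TurnR else TurnL.

Lemma mirror_path_tree x : mirror (path_tree x) = path_tree (map flip x).
Proof. by elim: x => //= -[] x /= ->. Qed.

Lemma mirror_RightTurnTree p q : mirror (RightTurnTree p q) = LeftTurnTree p q.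
Proof. by rewrite mirror_path_tree map_cat !map_nseq. Qed.

(** * Path trees and conditions on partial sums *)

Lemma parses_TurnR x a w :
  parses (path_tree (TurnR :: x)) (a :: w) =
  parses (path_tree x) w && (wsum (a :: w) != 0).
Proof.
apply/parses_nodeP/andP=> [[u [v [e]]]|[pw nz]].
  rewrite parses_leaf => /eqP; case: u e => [|b []] //= [-> ->] _.
  by split.
by exists [:: a], w; rewrite parses_leaf.
Qed.

Lemma parses_TurnL x w a :
  parses (path_tree (TurnL :: x)) (rcons w a) =
  parses (path_tree x) w && (wsum (rcons w a) != 0).
Proof.
rewrite -parses_mirror mirror_path_tree /= rev_rcons parses_TurnR.
by rewrite -mirror_path_tree parses_mirror -rev_rcons wsum_rev.
Qed.

Lemma nleaves_path_tree x : nleaves (path_tree x) = (size x + 2)%N.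
Proof. by elim: x => //= -[] x /= ->; lia. Qed.

(** The subtrees along the spine of a right comb have the suffixes of [w] as leaf words; the
    one-letter suffix [i = s.+1] has nonzero sum because it is a letter. *)
Lemma parses_TurnR_nseq s w : size w = s.+2 ->
  parses (path_tree (nseq s TurnR)) w <->
  (forall i, (i < s.+2)%N -> wsum (drop i w) != 0).
Proof.
elim: s w => [|s IHs] [|a w] //= [sw].
  case: w sw => [|b []] //= _; split=> [pw [|[|i]] //= _|nz].
  - exact: parses_sum_neq0 pw.
  - by rewrite /wsum big_seq1 vec_neq0.
  apply/parses_nodeP; exists [:: a], [:: b]; rewrite !parses_leaf; split=> //.
  exact: (nz 0%N).
rewrite (parses_TurnR (nseq s TurnR)); split=> [/andP[/IHs H nz] [|i] // hi|nz].
  by apply: H.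
apply/andP; split; last exact: (nz 0%N).
by apply/IHs => // i hi; apply: (nz i.+1).
Qed.

(** Each left turn splits off the last letter, so the spine vertices down to the root of
    [path_tree x] carry prefixes of [w]. *)
Lemma parses_TurnL_nseq p x w : size w = (p + (size x + 2))%N ->
  parses (path_tree (nseq p TurnL ++ x)) w <->
  parses (path_tree x) (take (size x + 2) w) /\
  (forall j, (size x + 2 <= j <= size w)%N -> psum w j != 0).
Proof.
elim: p w => [|p IHp] w sw.
  rewrite add0n in sw; rewrite -sw take_size; split=> [pw|[]//].
  split=> // j hj; have -> : j = size w by lia.
  rewrite /psum take_size; exact: parses_sum_neq0 pw.
case/lastP: w sw => // w a; rewrite size_rcons => -[sw].
have psum_rcons j : (j <= size w)%N -> psum (rcons w a) j = psum w j.
  by move=> hj; rewrite /psum -cats1 takel_cat.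
rewrite (parses_TurnL (nseq p TurnL ++ x)) -cats1 takel_cat; last lia.
rewrite cats1; split=> [/andP[/(IHp _ sw)[px nz] nzw]|[px nz]].
  split=> // j; case: (ltngtP j (size w).+1) => [hj hj'|?|-> _]; first last.
  - by rewrite /psum -(size_rcons w a) take_size.
  - lia.
  by rewrite psum_rcons; [apply: nz; lia|lia].
apply/andP; split.
  by apply/(IHp _ sw); split=> // j hj; rewrite -psum_rcons; [apply: nz|]; lia.
have: psum (rcons w a) (size w).+1 != 0 by apply: nz; lia.
by rewrite /psum -(size_rcons w a) take_size.
Qed.

Lemma parses_LeftTurnTree p q w : (2 <= q)%N -> size w = (p + q)%N ->
  parses (LeftTurnTree p q) w <->
  (forall i, (i < q)%N -> psum w i != psum w q) /\
  (forall j, (q <= j <= p + q)%N -> psum w j != 0).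
Proof.
case: q => [|[|q]] // _ sw; rewrite /LeftTurnTree subn2 /=.
have eq : (size (nseq q TurnR) + 2)%N = q.+2 by rewrite size_nseq addn2.
have st : size (take q.+2 w) = q.+2 by rewrite size_takel ?sw // leq_addl.
(* A suffix of the prefix of length [q.+2] has a difference of two partial sums as its sum. *)
have E i : (i < q.+2)%N ->
    (wsum (drop i (take q.+2 w)) != 0) = (psum w i != psum w q.+2).
  by move=> hi; rewrite wsum_drop /psum take_takel ?(ltnW hi) // subr_eq0 eq_sym.
rewrite parses_TurnL_nseq eq // parses_TurnR_nseq // sw.
by split=> -[nz ?]; split=> // i hi; [rewrite -E | rewrite E]; auto.
Qed.

(** Mirror image of the left turn case: reversing [w] replaces S_i by S_N - S_(N-i), where N = p +
    q. *)
Lemma parses_RightTurnTree p q w : (2 <= q)%N -> size w = (p + q)%N ->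
  parses (RightTurnTree p q) w <->
  (forall i, (p < i <= p + q)%N -> psum w i != psum w p) /\
  (forall j, (j <= p)%N -> psum w j != psum w (p + q)).
Proof.
move=> hq sw; rewrite -parses_mirror mirror_RightTurnTree.
rewrite parses_LeftTurnTree ?size_rev //.
split=> -[H1 H2]; split=> i hi.
- have := H1 (p + q - i)%N; rewrite !psum_rev ?sw; try lia.
  rewrite (inj_eq (addrI _)) eqr_opp subKn ?addnK; last lia.
  by apply; lia.
- have := H2 (p + q - i)%N; rewrite !psum_rev ?sw; try lia.
  by rewrite subr_eq0 eq_sym subKn; [apply; lia|lia].
- rewrite !psum_rev ?sw; try lia.
  by rewrite (inj_eq (addrI _)) eqr_opp addnK; apply: H1; lia.
- rewrite psum_rev ?sw; last lia.
  by rewrite subr_eq0 eq_sym; apply: H2; lia.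
Qed.

(** * Uniqueness of the sequence of partial sums *)

Definition turn_sums (n k N : nat) (S : nat -> F22) : Prop :=
  [/\ forall i, (i < n)%N -> S i != S n,
      forall j, (n <= j <= N)%N -> S j != 0,
      forall j, (k < j <= N)%N -> S j != S k &
      forall i, (i <= k)%N -> S i != S N].

Definition alternate (T : Type) (x y : T) (i : nat) : T := if odd i then y else x.

Lemma alternate_unique (T : eqType) (u : nat -> T) x y l :
    u 0%N = x -> (forall i, (i < l)%N -> u i.+1 != u i) ->
    (forall i, (i <= l)%N -> u i \in [:: x; y]) ->
  forall i, (i <= l)%N -> u i = alternate x y i.
Proof.
move=> u0 du hu; elim=> [|i IHi] // hi.
have := hu _ hi; have := du _ hi; rewrite IHi ?(ltnW hi) // /alternate !inE /=.
by case: (odd i) => /= /negPf-> // ; rewrite ?orbF /= => /eqP.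
Qed.

(** The forced sequence with S_n = a and S_N = c. The last block is read backwards from N; besides
    [c] it takes whichever of [a] and [a + c] is not S_k. *)
Definition block_sums (n k N : nat) (a c : F22) (i : nat) : F22 :=
  if (i < n)%N then alternate 0 (a + c) i
  else if (i <= k)%N then alternate a (a + c) (i - n)
  else alternate c (alternate (a + c) a (k - n)) (N - i).

Lemma F22_span (a c v : F22) : a != 0 -> c != 0 -> a != c ->
  v \in [:: 0; a; c; a + c].
Proof. by case: a c v => [[] []] [[] []] [[] []]. Qed.

Lemma turn_sums_unique n k N S : (0 < n <= k)%N -> (k < N)%N ->
    S 0%N = 0 -> (forall i, (i < N)%N -> S i.+1 != S i) -> turn_sums n k N S ->
  forall i, (i <= N)%N -> S i = block_sums n k N (S n) (S N) i.
Proof.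
move=> hnk hkN S0 dS [An A0 Ak AN].
have a0 : S n != 0 by apply: A0; lia.
have c0 : S N != 0 by apply: A0; lia.
have ac : S n != S N by apply: AN; lia.
have span v := F22_span v a0 c0 ac.
(* Avoiding S_n and S_N leaves 0 and their sum. *)
have B1 i : (i <= n.-1)%N -> S i = alternate 0 (S n + S N) i.
  apply: alternate_unique => // j hj; first by apply: dS; lia.
  have := span (S j); rewrite !inE.
  have /negPf-> : S j != S n by apply: An; lia.
  by have /negPf-> : S j != S N by apply: AN; lia.
(* Avoiding 0 and S_N leaves S_n and S_n + S_N. *)
have B2 i : (i <= k - n)%N -> S (n + i)%N = alternate (S n) (S n + S N) i.
  apply: (@alternate_unique _ (fun i => S (n + i)%N)) => [|j hj|j hj].
  - by rewrite addn0.
  - by rewrite addnS; apply: dS; lia.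
  have := span (S (n + j)%N); rewrite !inE.
  have /negPf-> : S (n + j)%N != 0 by apply: A0; lia.
  by have /negPf-> : S (n + j)%N != S N by apply: AN; lia.
have Sk : S k = alternate (S n) (S n + S N) (k - n).
  by rewrite -B2 // subnKC //; lia.
(* The last block avoids 0 and S_k; going down from N starts the alternation at the known value
   S_N. *)
have B3 i : (i <= N - k.+1)%N ->
    S (N - i)%N = alternate (S N) (alternate (S n + S N) (S n) (k - n)) i.
  apply: (@alternate_unique _ (fun i => S (N - i)%N)) => [|j hj|j hj].
  - by rewrite subn0.
  - rewrite eq_sym; have -> : (N - j = (N - j.+1).+1)%N by lia.
    by apply: dS; lia.
  have := span (S (N - j)%N); rewrite !inE.
  have /negPf-> : S (N - j)%N != 0 by apply: A0; lia.
  have /negPf : S (N - j)%N != S k by apply: Ak; lia.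
  rewrite Sk /alternate; case: (odd _) => -> //=; rewrite ?orbF //.
  by rewrite orbC.
move=> i hi; rewrite /block_sums; case: ltnP => hin; first by apply: B1; lia.
case: leqP => hik; first by rewrite -B2 ?subnKC //; lia.
by rewrite -B3 ?subKn //; lia.
Qed.

(** * Existence: the forced sequence meets all the conditions *)

Section BlockSums.

Variables (n k N : nat).
Hypotheses (hnk : (0 < n <= k)%N) (hkN : (k < N)%N).

Let a : F22 := (true, false).
Let c : F22 := (false, true).
Let S := block_sums n k N a c.

Lemma block_sums0 : S 0%N = 0.
Proof. by rewrite /S /block_sums; case: ltnP => //; lia. Qed.

Lemma block_sums_step i : (i < N)%N -> S i.+1 != S i.
Proof.
move=> hi; rewrite /S /block_sums /alternate.
have [hin|hin] := ltnP i n.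
  case: ltnP => hin' /=; first by case: odd.
  (* Here [i.+1 = n]: the new value [a] is neither 0 nor [a + c]. *)
  have -> : (i.+1 <= k)%N by lia.
  have -> : (i.+1 - n = 0)%N by lia.
  by rewrite /=; case: (odd i).
have -> : (i.+1 < n)%N = false by lia.
have [hik|hik] := leqP i k; last first.
  have -> : (i.+1 <= k)%N = false by lia.
  have -> : (N - i = (N - i.+1).+1)%N by lia.
  by rewrite /=; case: odd; case: odd.
case: (ltnP i k) => hik'; first by rewrite subSn //=; case: odd.
(* Entering the last block: neither of its two values equals S_k. *)
have -> : i = k by lia.
by do 2!case: odd.
Qed.

Lemma block_sums_turn : turn_sums n k N S.
Proof.
rewrite /S /block_sums /alternate; split=> i hi.
- by rewrite hi ltnn subnn; case: leqP => hnk'; [case: odd | lia].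
- have -> : (i < n)%N = false by lia.
  by case: leqP => _; case: (odd _) => //; case: (odd _).
- have -> : (i < n)%N = false by lia.
  have -> : (i <= k)%N = false by lia.
  have -> : (k < n)%N = false by lia.
  by rewrite leqnn; case: (odd _) => //; case: (odd _).
- have -> : (N < n)%N = false by lia.
  have -> : (N <= k)%N = false by lia.
  by rewrite hi subnn; case: ltnP => _; case: odd.
Qed.

End BlockSums.

(** Consecutive differences are nonzero, hence vectors of letters. *)
Lemma ex_word_psum (S : nat -> F22) N :
    S 0%N = 0 -> (forall i, (i < N)%N -> S i.+1 != S i) ->
  exists2 w : seq 'I_3, size w = N & forall i, (i <= N)%N -> psum w i = S i.
Proof.
move=> S0 dS; exists (mkseq (fun i => letter (S i.+1 - S i)) N).
  by rewrite size_mkseq.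
elim=> [|i IHi] hi; first by rewrite psum0 S0.
rewrite psumS ?size_mkseq // nth_mkseq // letterK ?subr_eq0 ?dS //.
by rewrite IHi ?(ltnW hi) // addrC subrK.
Qed.

(** * Letter permutations as linear maps *)

Definition perm_vec (s : 'S_3) (v : F22) : F22 :=
  if v == 0 then 0 else vec (s (letter v)).

Lemma perm_vec_vec s a : perm_vec s (vec a) = vec (s a).
Proof.
rewrite /perm_vec (negPf (vec_neq0 a)); congr (vec (s _)).
by apply: vec_inj; rewrite letterK // vec_neq0.
Qed.

Lemma F22_addvv (v : F22) : v + v = 0.
Proof. by case: v => [[] []]. Qed.

(** The sum of two distinct nonzero vectors is the third one, so [ruleE] turns additivity into
    preservation of pairwise distinctness by the injection [s]. *)
Lemma perm_vecD s : {morph perm_vec s : u v / u + v}.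
Proof.
have s0 : perm_vec s 0 = 0 by rewrite /perm_vec eqxx.
move=> u v; have [->|u0] := eqVneq u 0; first by rewrite s0 !add0r.
have [->|v0] := eqVneq v 0; first by rewrite s0 !addr0.
have [->|uv] := eqVneq u v; first by rewrite !F22_addvv.
have uv0 : u + v != 0 by apply: contra uv; case: (u) (v) => [[] []] [[] []].
have : rule (letter (u + v)) (letter u) (letter v) by rewrite ruleE !letterK.
rewrite /rule -(map_inj_uniq (@perm_inj _ s)) -[uniq _]/(rule _ _ _) ruleE.
by rewrite -!perm_vec_vec !letterK // => /eqP.
Qed.

Lemma perm_vec_block_sums s n k N a c i :
  perm_vec s (block_sums n k N a c i) =
  block_sums n k N (perm_vec s a) (perm_vec s c) i.
Proof.
rewrite /block_sums /alternate -perm_vecD.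
by do ?case: ifP => _ //; rewrite /perm_vec eqxx.
Qed.

Lemma ex_perm2 (T : finType) (x1 y1 x2 y2 : T) : x1 != y1 -> x2 != y2 ->
  exists s : {perm T}, s x1 = x2 /\ s y1 = y2.
Proof.
(* The left factor acts first and sends [x1] to [x2]; the second sends the image of [y1] to [y2] and
   fixes [x2]. *)
move=> h1 h2; exists (tperm x1 x2 * tperm (tperm x1 x2 y1) y2)%g.
rewrite !permM !tpermL tpermD //; last by rewrite eq_sym.
by rewrite -{2}(tpermL x1 x2) (inj_eq perm_inj) eq_sym.
Qed.

Lemma ex_perm_vec (a c a' c' : F22) :
    a != 0 -> c != 0 -> a != c -> a' != 0 -> c' != 0 -> a' != c' ->
  exists s, perm_vec s a = a' /\ perm_vec s c = c'.
Proof.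
move=> a0 c0 ac a0' c0' ac'.
have L u v : u != 0 -> v != 0 -> u != v -> letter u != letter v.
  by move=> u0 v0; apply: contra => /eqP e; rewrite -(letterK u0) e letterK.
have [s [sa sc]] := ex_perm2 (L _ _ a0 c0 ac) (L _ _ a0' c0' ac').
exists s; rewrite -(letterK a0) -(letterK c0) !perm_vec_vec sa sc.
by rewrite !letterK.
Qed.

Lemma psum_step w i : (i < size w)%N -> psum w i.+1 != psum w i.
Proof. by move=> hi; rewrite psumS // addrC -subr_eq0 addrK vec_neq0. Qed.

(** Choose [s] matching the pairs (S_n, S_N) of the two words; as [block_sums] commutes with
    [perm_vec s], all partial sums match. *)
Lemma turn_sums_perm n k N w w' : (0 < n <= k)%N -> (k < N)%N ->
    size w = N -> size w' = N ->
    turn_sums n k N (psum w) -> turn_sums n k N (psum w') ->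
  exists s : 'S_3, w' = map s w.
Proof.
move=> hnk hkN sw sw' ts ts'.
have nz u : turn_sums n k N (psum u) ->
    [/\ psum u n != 0, psum u N != 0 & psum u n != psum u N].
  by case=> [_ A0 _ AN]; split; [apply: A0|apply: A0|apply: AN]; lia.
have [a0 c0 ac] := nz _ ts; have [a0' c0' ac'] := nz _ ts'.
have [s [sa sc]] := ex_perm_vec a0 c0 ac a0' c0' ac'.
have E u : size u = N -> turn_sums n k N (psum u) ->
    forall i, (i <= N)%N -> psum u i = block_sums n k N (psum u n) (psum u N) i.
  move=> su; apply: turn_sums_unique => //; first exact: psum0.
  by move=> i hi; apply: psum_step; rewrite su.
have Es i : (i <= N)%N -> psum w' i = perm_vec s (psum w i).
  by move=> hi; rewrite E // [in RHS]E // perm_vec_block_sums sa sc.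
exists s; apply: (@eq_from_nth _ ord0) => [|i]; rewrite ?size_map sw' // => hi.
rewrite (nth_map ord0) ?sw //; apply: vec_inj; rewrite -perm_vec_vec.
(* Letters are compared through the partial sums before and after them. *)
apply: (addrI (psum w' i)); rewrite -psumS ?sw' // !Es ?(ltnW hi) //.
by rewrite psumS ?sw // perm_vecD.
Qed.

(** * Classes of words and the count *)

Lemma word_class_map n (w : n.-tuple 'I_3) (s : 'S_3) :
  word_class (map_tuple s w) = word_class w.
Proof.
apply/setP=> t; apply/imsetP/imsetP=> -[r _ ->].
  exists (s * r)%g => //; apply: val_inj => /=.
  by rewrite -map_comp; apply: eq_map => x; rewrite permM.
exists (s^-1 * r)%g => //; apply: val_inj => /=.
by rewrite -map_comp; apply: eq_map => x; rewrite /= permM permK.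
Qed.

Local Close Scope ring_scope.

Theorem theorem14 (m k n : nat) (hm : 1 <= m) (hk : 1 <= k)
  (hn : maxn 2 (k - m + 2) <= n <= k) :
  #|ParseWords (LeftTurnTree m n) (RightTurnTree k (m + n - k))| = 1.
Proof.
have hnk : 0 < n <= k by lia.
have hkN : k < m + n by lia.
have hl : nleaves (LeftTurnTree m n) = m + n.
  by rewrite nleaves_path_tree size_cat !size_nseq; lia.
have P w : size w = m + n ->
    parses (LeftTurnTree m n) w && parses (RightTurnTree k (m + n - k)) w <->
    turn_sums n k (m + n) (psum w).
  move=> sw.
  (* The lower bound on [n] gives m + n - k >= 2, so the subtraction is not truncated. *)
  have eN : k + (m + n - k) = m + n by lia.
  have hL := @parses_LeftTurnTree m n w ltac:(lia) sw.
  have hR := @parses_RightTurnTree k (m + n - k) w ltac:(lia) ltac:(lia).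
  rewrite eN in hR; split.
    by case/andP=> /hL[? ?] /hR[? ?].
  by case=> ? ? ? ?; apply/andP; split; [apply/hL | apply/hR].
(* [w0] realizes the explicit sequence; its class is the single element. *)
have [w0 sw0 ew0] := ex_word_psum (block_sums0 hnk hkN)
  (fun i hi => block_sums_step hnk hkN hi).
have ts0 : turn_sums n k (m + n) (psum w0).
  have [A1 A2 A3 A4] := block_sums_turn hnk hkN.
  by split=> i hi; rewrite !ew0; auto; lia.
have sz0 : size w0 == nleaves (LeftTurnTree m n) by rewrite hl sw0.
apply/eqP/cards1P; exists (word_class (Tuple sz0)).
apply/setP=> C; rewrite inE; apply/imsetP/eqP=> [[w]|->]; last first.
  by exists (Tuple sz0) => //; rewrite inE; apply/P.
rewrite inE => pw ->; have sw : size w = m + n by rewrite size_tuple hl.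
have [s es] := turn_sums_perm hnk hkN sw0 sw ts0 (proj1 (P _ sw) pw).
by rewrite -(word_class_map (Tuple sz0) s); congr word_class; apply: val_inj.
Qed.
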